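(* There is an absolute constant $C>1$ with the following property. Let $E\subset\mathbb{R}^2$ be a compact, path connected set, let $r>0$, and let $\Gamma^\ast_r$ be an $r$-maximum distance minimizer of $B(E,r)$. Then $$B(\Gamma^\ast_r,r)\subset B(E,Cr).$$
   Context: For $A\subset\mathbb{R}^2$ and $r>0$, $B(A,r):=\{x:\mathrm{dist}(x,A)\le r\}$ (closed $r$-neighborhood). A rectifiable curve is the image of a Lipschitz map $[0,1]\to\mathbb{R}^2$. $\Lambda(E,r):=\inf\{\mathcal{H}^1(\Gamma):\Gamma \text{ a rectifiable curve with } B(\Gamma,r)\supset E\}$. An $r$-maximum distance minimizer of a set $K$ is a rectifiable curve $\Gamma$ with $B(\Gamma,r)\supset K$ and $\mathcal{H}^1(\Gamma)=\Lambda(K,r)$. *)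

(* Defs.v *)
(* The plane R^2 is modelled as R * R with the
   Euclidean distance defined explicitly (mathcomp's norm on R*R is the
   max-norm, so we do not use it for metric quantities). *)
From HB Require Import structures.
From mathcomp Require Import all_boot all_order all_algebra.
From mathcomp Require Import all_classical all_reals all_analysis.
Set Implicit Arguments. Unset Strict Implicit. Unset Printing Implicit Defensive.
Import Order.TTheory GRing.Theory Num.Theory.
Import numFieldNormedType.Exports.
Local Open Scope classical_set_scope.
Local Open Scope ring_scope.

Section Defs.
Variable R : realType.
Notation pt := (R * R)%type.

Definition edist (x y : pt) : R :=
  Num.sqrt ((x.1 - y.1) ^+ 2 + (x.2 - y.2) ^+ 2).

(* distance from a point to a set, in the extended reals (+oo for the empty set) *)
Definition dist_set (x : pt) (A : set pt) : \bar R :=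
  ereal_inf [set (edist x a)%:E | a in A].

Definition nbhd_closed (A : set pt) (r : R) : set pt :=
  [set x | (dist_set x A <= r%:E)%E].

(* diameter of a set (0 for the empty set) *)
Definition ediam (U : set pt) : \bar R :=
  ereal_sup ([set 0%E] `|` [set (edist x y)%:E | x in U & y in U]).

Definition hausdorff1_delta (delta : R) (A : set pt) : \bar R :=
  ereal_inf [set (\sum_(0 <= i <oo) ediam (U i))%E |
    U in [set U : nat -> set pt |
      A `<=` \bigcup_i U i /\ forall i, (ediam (U i) <= delta%:E)%E]].

Definition hausdorff1 (A : set pt) : \bar R :=
  ereal_sup [set hausdorff1_delta delta A | delta in [set d : R | 0 < d]].

Definition lipschitz01 (f : R -> pt) : Prop :=
  exists L : R, forall s t, s \in `[0, 1] -> t \in `[0, 1] ->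
    edist (f s) (f t) <= L * `|s - t|.

Definition rectifiable_curve (G : set pt) : Prop :=
  exists f : R -> pt, lipschitz01 f /\ G = f @` `[0, 1].

Definition Lambda (E : set pt) (r : R) : \bar R :=
  ereal_inf [set hausdorff1 G |
    G in [set G | rectifiable_curve G /\ E `<=` nbhd_closed G r]].

Definition max_dist_minimizer (K : set pt) (r : R) (G : set pt) : Prop :=
  [/\ rectifiable_curve G, K `<=` nbhd_closed G r & hausdorff1 G = Lambda K r].

Definition path_connected (E : set pt) : Prop :=
  forall x y, E x -> E y -> exists g : R -> pt,
    [/\ {within `[0, 1], continuous g}, g 0 = x, g 1 = y & g @` `[0, 1] `<=` E].

End Defs.

(* Main.v *)
(* Suppose the minimizer G has a point p at distance more than 198 r from E, and
   let L(rho) be the length of G inside the square of centre p and half-side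
   rho. As long as that square stays far from E, its content covers no point of
   B(E, r), so it can be traded for something cheaper.
   - Replacing the content of the square by its boundary keeps the curve
     connected, hence L(rho) <= 8 rho, up to a small enlargement of rho.
   - Removing the content altogether leaves m connected pieces that matter, each
     running from the square of half-side rho to the one of half-side rho + r,
     hence L(rho + r) >= L(rho) + m r. Since E is connected and lies within 3 r
     of the pieces, m - 1 segments of length at most 8 r reconnect them, hence
     L(rho) <= 8 r (m - 1).
   The last two bounds give L(rho + r) >= 9/8 L(rho) + r, up to the same
   enlargement: L grows exponentially, which contradicts the linear bound after
   42 steps of size 2 r. The pieces are finitely many arcs of a Lipschitz
   parametrization of G, so they are curves themselves. *)
From Pilot Require Import Defs.
From HB Require Import structures.
From mathcomp Require Import all_boot all_order all_algebra.
From mathcomp Require Import all_classical all_reals all_analysis.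
From mathcomp Require Import ring lra zify.
Set Implicit Arguments. Unset Strict Implicit. Unset Printing Implicit Defensive.
Import Order.TTheory GRing.Theory Num.Theory.
Import numFieldNormedType.Exports.
Import Pilot.Defs.
Local Open Scope classical_set_scope.
Local Open Scope ring_scope.

(** * Euclidean and sup distances in the plane *)

Section EuclideanPlane.
Context {R : realType}.
Implicit Types (x y z p : R * R) (A B U : set (R * R)) (r e : R).

Lemma edist_ge0 x y : 0 <= edist x y.
Proof. exact: sqrtr_ge0. Qed.

Lemma edistC x y : edist x y = edist y x.
Proof. by rewrite /edist; congr Num.sqrt; ring. Qed.

Lemma edistxx x : edist x x = 0.
Proof. by rewrite /edist !subrr expr0n /= addr0 sqrtr0. Qed.

Lemma edist_triangle y x z : edist x z <= edist x y + edist y z.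
Proof.
rewrite /edist.
set a := x.1 - y.1; set b := x.2 - y.2.
set c := y.1 - z.1; set d := y.2 - z.2.
have -> : x.1 - z.1 = a + c by rewrite /a /c; ring.
have -> : x.2 - z.2 = b + d by rewrite /b /d; ring.
have ab0 : 0 <= a ^+ 2 + b ^+ 2 by rewrite addr_ge0 ?sqr_ge0.
have cd0 : 0 <= c ^+ 2 + d ^+ 2 by rewrite addr_ge0 ?sqr_ge0.
rewrite -[leRHS]ger0_norm ?addr_ge0 ?sqrtr_ge0 // -sqrtr_sqr.
rewrite ler_sqrt ?sqr_ge0 // [leRHS]sqrrD !sqr_sqrtr // -sqrtrM //.
suff : a * c + b * d <= Num.sqrt ((a ^+ 2 + b ^+ 2) * (c ^+ 2 + d ^+ 2)).
  by rewrite -mulr_natl; nra.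
rewrite (le_trans (ler_norm _)) // -sqrtr_sqr ler_sqrt ?mulr_ge0 //.
(* Lagrange's identity: the squares of the two sides of Cauchy-Schwarz differ by
   [(a * d - b * c) ^+ 2]. *)
by rewrite -subr_ge0; have := sqr_ge0 (a * d - b * c); nra.
Qed.

Lemma norm_fst_le_edist x y : `|x.1 - y.1| <= edist x y.
Proof. by rewrite -sqrtr_sqr ler_sqrt ?addr_ge0 ?sqr_ge0 // lerDl sqr_ge0. Qed.

Lemma norm_snd_le_edist x y : `|x.2 - y.2| <= edist x y.
Proof. by rewrite -sqrtr_sqr ler_sqrt ?addr_ge0 ?sqr_ge0 // lerDr sqr_ge0. Qed.

Lemma edist_le_normD x y : edist x y <= `|x.1 - y.1| + `|x.2 - y.2|.
Proof.
rewrite -[leRHS]ger0_norm ?addr_ge0 // -sqrtr_sqr ler_sqrt ?sqr_ge0 //.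
rewrite -[in leLHS](real_normK (num_real (x.1 - y.1))).
rewrite -[in leLHS](real_normK (num_real (x.2 - y.2))).
by have := mulr_ge0 (normr_ge0 (x.1 - y.1)) (normr_ge0 (x.2 - y.2)); nra.
Qed.

(** The squares of the proof are the balls of this distance: it is 1-Lipschitz for [edist], and its
    spheres consist of four segments, which are explicit rectifiable curves. *)
Definition sup_dist p x : R := Num.max `|x.1 - p.1| `|x.2 - p.2|.

Lemma sup_dist_self p : sup_dist p p = 0.
Proof. by rewrite /sup_dist !subrr normr0 maxxx. Qed.

Lemma sup_dist_lip p x y : `|sup_dist p x - sup_dist p y| <= edist x y.
Proof.
have H u v : sup_dist p u <= sup_dist p v + edist u v.
  rewrite ge_max; apply/andP; split.
    rewrite (@le_trans _ _ (`|v.1 - p.1| + `|u.1 - v.1|)) //.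
      have -> : u.1 - p.1 = (v.1 - p.1) + (u.1 - v.1) by ring.
      exact: ler_normD.
    by rewrite lerD ?norm_fst_le_edist // le_max lexx.
  rewrite (@le_trans _ _ (`|v.2 - p.2| + `|u.2 - v.2|)) //.
    have -> : u.2 - p.2 = (v.2 - p.2) + (u.2 - v.2) by ring.
    exact: ler_normD.
  by rewrite lerD ?norm_snd_le_edist // le_max lexx orbT.
by have := H x y; have := H y x; rewrite (edistC y) ler_norml; lra.
Qed.

Lemma edist_le_sup_dist p x : edist x p <= 2 * sup_dist p x.
Proof.
rewrite (le_trans (edist_le_normD _ _)) // mulr_natl mulr2n.
by rewrite lerD // le_max lexx ?orbT.
Qed.

(** The infimum defining the distance to [A] may not be attained, whence the slack [e]. *)
Lemma nbhd_closed_lt A r x e : nbhd_closed A r x -> 0 < e ->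
  exists2 a, A a & edist x a < r + e.
Proof.
move=> xA e0; apply: contrapT => noA.
suff : ((r + e)%:E <= dist_set x A)%E.
  by move=> /le_trans /(_ xA); rewrite lee_fin; lra.
apply: le_ereal_inf_tmp => _ [a Aa <-]; rewrite lee_fin leNgt.
by apply/negP => xa; apply: noA; exists a.
Qed.

Lemma nbhd_closedP A r x :
  (forall e, 0 < e -> exists2 a, A a & edist x a <= r + e) -> nbhd_closed A r x.
Proof.
move=> xA; apply/lee_addgt0Pr => e e0; have [a Aa xa] := xA _ e0.
by rewrite -EFinD ge_ereal_inf //; exists (edist x a)%:E; [exists a|rewrite lee_fin].
Qed.

Lemma nbhd_closed_near A r x a : A a -> edist x a <= r -> nbhd_closed A r x.
Proof.
by move=> Aa xa; apply: nbhd_closedP => e e0; exists a => //; lra.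
Qed.

Local Open Scope ereal_scope.

Lemma ediam_ge0 U : 0 <= ediam U.
Proof. by apply: ereal_sup_ubound; left. Qed.

Lemma edist_le_ediam U x y : U x -> U y -> (edist x y)%:E <= ediam U.
Proof. by move=> Ux Uy; apply: ereal_sup_ubound; right; exists x => //; exists y. Qed.

Lemma ediam_le U (d : R) : (0 <= d)%R ->
  (forall x y, U x -> U y -> (edist x y <= d)%R) -> ediam U <= d%:E.
Proof.
move=> d0 Ud; apply: ge_ereal_sup => _ [->|[x Ux [y Uy <-]]]; rewrite lee_fin //.
exact: Ud.
Qed.

Lemma ediam0 : @ediam R set0 = 0.
Proof. by apply/eqP; rewrite eq_le ediam_ge0 andbT; exact: ediam_le. Qed.

End EuclideanPlane.

(** * One-dimensional Hausdorff measure *)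

Section HausdorffMeasure.
Context {R : realType}.
Implicit Types (A B : set (R * R)) (U V : nat -> set (R * R)) (d e : R).

Local Open Scope ereal_scope.

Lemma nneseries_ediam_ge0 U : 0 <= \sum_(0 <= i <oo) ediam (U i).
Proof. by apply: nneseries_ge0 => *; exact: ediam_ge0. Qed.

Lemma hausdorff1_delta_le_cover d A U : A `<=` \bigcup_i U i ->
  (forall i, ediam (U i) <= d%:E) ->
  hausdorff1_delta d A <= \sum_(0 <= i <oo) ediam (U i).
Proof. by move=> AU Ud; apply: ereal_inf_lbound; exists U. Qed.

Lemma hausdorff1_delta_ge0 d A : 0 <= hausdorff1_delta d A.
Proof. by apply: le_ereal_inf_tmp => _ [U _ <-]; exact: nneseries_ediam_ge0. Qed.

Lemma hausdorff1_delta_subset d A B : A `<=` B ->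
  hausdorff1_delta d A <= hausdorff1_delta d B.
Proof.
move=> AB; apply: ereal_inf_le_tmp; apply: image_subset => U [BU Ud].
by split => //; exact: subset_trans BU.
Qed.

Lemma hausdorff1_delta_antitone d e A : (d <= e)%R ->
  hausdorff1_delta e A <= hausdorff1_delta d A.
Proof.
move=> de; apply: ereal_inf_le_tmp; apply: image_subset => U [AU Ud].
by split => // i; rewrite (le_trans (Ud i)) ?lee_fin.
Qed.

Lemma hausdorff1_delta_le d A : (0 < d)%R -> hausdorff1_delta d A <= hausdorff1 A.
Proof. by move=> d0; apply: ereal_sup_ubound; exists d. Qed.

Lemma hausdorff1_le A (x : \bar R) :
  (forall d : R, (0 < d)%R -> hausdorff1_delta d A <= x) -> hausdorff1 A <= x.
Proof. by move=> Ax; apply: ge_ereal_sup => _ [d d0 <-]; exact: Ax. Qed.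

Lemma hausdorff1_ge0 A : 0 <= hausdorff1 A.
Proof. exact: le_trans (hausdorff1_delta_ge0 1 A) (hausdorff1_delta_le _ ltr01). Qed.

Lemma hausdorff1_subset A B : A `<=` B -> hausdorff1 A <= hausdorff1 B.
Proof.
move=> AB; apply: hausdorff1_le => d d0.
exact: le_trans (hausdorff1_delta_subset d AB) (hausdorff1_delta_le _ d0).
Qed.

(** Serves to merge two countable covers into one: a partial sum of even length splits into its even
    and its odd terms. *)
Lemma nneseries_interleave (u v : nat -> \bar R) :
  (forall n, 0 <= u n) -> (forall n, 0 <= v n) ->
  \sum_(0 <= i <oo) (if odd i then v i./2 else u i./2) <=
  \sum_(0 <= i <oo) u i + \sum_(0 <= i <oo) v i.
Proof.
move=> u0 v0; set w := fun i => if odd i then v i./2 else u i./2.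
have w0 n : 0 <= w n by rewrite /w; case: ifP.
apply: lime_le; first by apply: is_cvg_nneseries => *; exact: w0.
apply: nearW => n; rewrite (@le_trans _ _ (\sum_(0 <= i < n.*2) w i)) //.
  by apply: lee_sum_nneg_natr => [*|]; [exact: w0|rewrite -addnn leq_addr].
have -> : \sum_(0 <= i < n.*2) w i =
    \sum_(0 <= i < n) u i + \sum_(0 <= i < n) v i.
  elim: n => [|n IH]; first by rewrite !big_geq ?adde0.
  rewrite doubleS !big_nat_recr //= IH /w /= odd_double /= uphalf_double.
  by rewrite doubleK -addeA addeACA.
by rewrite leeD // nneseries_lim_ge.
Qed.

Lemma hausdorff1_deltaU d A B :
  hausdorff1_delta d (A `|` B) <= hausdorff1_delta d A + hausdorff1_delta d B.
Proof.
have finP C : hausdorff1_delta d C = +oo \/ hausdorff1_delta d C \is a fin_num.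
  have := hausdorff1_delta_ge0 d C.
  by case: (hausdorff1_delta d C) => //; [right|left].
have ANy C : hausdorff1_delta d C != -oo.
  by rewrite -ltNye (lt_le_trans _ (hausdorff1_delta_ge0 d C)) // ltNy0.
(* Near-optimal covers are available only when the infimum is finite; an infinite term makes the
   bound trivial. *)
case: (finP A) => [->|Afin]; first by rewrite addye ?leey.
case: (finP B) => [->|Bfin]; first by rewrite addey ?leey.
apply/lee_addgt0Pr => e e0.
have e20 : (0 < e / 2)%R by rewrite divr_gt0.
have [_ [U [AU Ud] <-] HU] := lb_ereal_inf_adherent e20 Afin.
have [_ [V [BV Vd] <-] HV] := lb_ereal_inf_adherent e20 Bfin.
pose W i := if odd i then V i./2 else U i./2.
have cover : A `|` B `<=` \bigcup_i W i.
  move=> x [/AU[i _ Ux]|/BV[i _ Vx]].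
    by exists i.*2 => //; rewrite /W odd_double doubleK.
  by exists i.*2.+1 => //; rewrite /W /= odd_double /= uphalf_double.
have Wd i : ediam (W i) <= d%:E by rewrite /W; case: ifP.
rewrite (le_trans (hausdorff1_delta_le_cover cover Wd)) //.
have -> : (fun n => \sum_(0 <= i < n) ediam (W i)) =
    (fun n => \sum_(0 <= i < n)
       (if odd i then ediam (V i./2) else ediam (U i./2))).
  by apply/funext => n; apply: eq_bigr => i _; rewrite /W; case: ifP.
apply: le_trans (nneseries_interleave (fun i => ediam_ge0 (U i))
  (fun i => ediam_ge0 (V i))) _.
have -> : e%:E = (e / 2)%:E + (e / 2)%:E :> \bar R by rewrite -EFinD -splitr.
by rewrite addeACA leeD // ltW.
Qed.

Lemma hausdorff1U A B : hausdorff1 (A `|` B) <= hausdorff1 A + hausdorff1 B.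
Proof.
apply: hausdorff1_le => d d0; rewrite (le_trans (hausdorff1_deltaU d A B)) //.
by rewrite leeD // hausdorff1_delta_le.
Qed.

(** A set of diameter at most [d < e] cannot meet both [A] and [B], so any cover of the union splits
    into a cover of each. *)
Lemma hausdorff1_delta_separated e d A B : (d < e)%R ->
  (forall x y, A x -> B y -> (e <= edist x y)%R) ->
  hausdorff1_delta d A + hausdorff1_delta d B <= hausdorff1_delta d (A `|` B).
Proof.
move=> de sep; apply: le_ereal_inf_tmp => _ [U [ABU Ud] <-].
(* Members missing [C] become empty rather than being dropped: the indices are kept and the series
   compare term by term. *)
pose W C i := if `[< U i `&` C !=set0 >] then U i else set0.
have cover C : C `<=` A `|` B -> C `<=` \bigcup_i W C i.
  move=> CAB x Cx; have [i _ Ux] := ABU _ (CAB _ Cx).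
  by exists i => //; rewrite /W asboolT //; exists x.
have Wd C i : ediam (W C i) <= d%:E.
  rewrite /W; case: ifP => // _; rewrite ediam0.
  exact: le_trans (ediam_ge0 (U i)) (Ud i).
have HA := hausdorff1_delta_le_cover (cover A (@subsetUl _ A B)) (Wd A).
have HB := hausdorff1_delta_le_cover (cover B (@subsetUr _ A B)) (Wd B).
rewrite (le_trans (leeD HA HB)) // -nneseriesD; last 2 first.
- by move=> *; exact: ediam_ge0.
- by move=> *; exact: ediam_ge0.
apply: lee_nneseries => i _.
  by rewrite adde_ge0 ?ediam_ge0.
rewrite /W; case: asboolP => [[x [Ux Ax]]|_]; case: asboolP => [[y [Uy By]]|_].
- have := le_trans (edist_le_ediam Ux Uy) (Ud i); rewrite lee_fin => xyd.
  by have := le_lt_trans (le_trans (sep _ _ Ax By) xyd) de; rewrite ltxx.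
- by rewrite ediam0 adde0.
- by rewrite ediam0 add0e.
- by rewrite ediam0 add0e ediam_ge0.
Qed.

(** Additivity on sets at positive distance, which dispenses with any measurability argument. *)
Lemma hausdorff1_separated e A B : (0 < e)%R ->
  (forall x y, A x -> B y -> (e <= edist x y)%R) ->
  hausdorff1 A + hausdorff1 B <= hausdorff1 (A `|` B).
Proof.
move=> e0 sep; have [->|ABfin] := eqVneq (hausdorff1 (A `|` B)) +oo; first exact: leey.
(* Two independent scales allow the two suprema to be taken one after the other; both are refined to
   a common scale below [e]. *)
have HD (d1 d2 : R) : (0 < d1)%R -> (0 < d2)%R ->
    hausdorff1_delta d1 A + hausdorff1_delta d2 B <= hausdorff1 (A `|` B).
  move=> d10 d20; pose d := Num.min (Num.min d1 d2) (e / 2)%R.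
  have d0 : (0 < d)%R by rewrite !lt_min d10 d20 divr_gt0.
  have de : (d < e)%R by rewrite gt_min; apply/orP; right; lra.
  rewrite (le_trans _ (hausdorff1_delta_le _ d0)) //.
  rewrite (le_trans _ (hausdorff1_delta_separated de sep)) // leeD //.
    by apply: hausdorff1_delta_antitone; rewrite !ge_min lexx.
  by apply: hausdorff1_delta_antitone; rewrite !ge_min lexx orbT.
have fin C : C `<=` A `|` B -> hausdorff1 C \is a fin_num.
  move=> CAB; rewrite ge0_fin_numE ?hausdorff1_ge0 //.
  by rewrite (le_lt_trans (hausdorff1_subset CAB)) // ltey.
have finB := fin _ (@subsetUr _ A B); have finA := fin _ (@subsetUl _ A B).
rewrite -leeBrDr //; apply: hausdorff1_le => d1 d10; rewrite leeBrDr // addeC.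
have finA1 : hausdorff1_delta d1 A \is a fin_num.
  rewrite ge0_fin_numE ?hausdorff1_delta_ge0 //.
  by rewrite (le_lt_trans (hausdorff1_delta_le _ d10)) // -ge0_fin_numE ?hausdorff1_ge0.
rewrite -leeBrDr //; apply: hausdorff1_le => d2 d20; rewrite leeBrDr // addeC.
exact: HD.
Qed.

(** A 1-Lipschitz map does not increase length: it sends a cover of [A] to a cover of [[a, b]] by
    intervals no longer than the diameters, and Lebesgue measure is countably subadditive. *)
Lemma hausdorff1_ge_itv (phi : R * R -> R) A (a b : R) :
  (forall x y, (`|phi x - phi y| <= edist x y)%R) ->
  (forall v, (a <= v <= b)%R -> exists2 x, A x & phi x = v) ->
  (b - a)%:E <= hausdorff1 A.
Proof.
move=> phi_lip Aphi; apply: le_trans (hausdorff1_delta_le A ltr01).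
apply: le_ereal_inf_tmp => _ [U [AU U1] <-].
pose d i := fine (ediam (U i)).
have dE i : ediam (U i) = (d i)%:E.
  rewrite /d fineK // ge0_fin_numE ?ediam_ge0 //.
  by rewrite (le_lt_trans (U1 i)) // ltry.
have Uphi i x y : U i x -> U i y -> (phi x - d i <= phi y)%R.
  move=> Ux Uy; have := edist_le_ediam Ux Uy; rewrite dE lee_fin.
  by move/(le_trans (phi_lip x y)); rewrite ler_norml; lra.
(* Contains the image of [U i], whose oscillation under [phi] is at most [d i]. *)
pose I i := `[inf (phi @` U i), inf (phi @` U i) + d i]%R.
have cover : [set` `[a, b]%R] `<=` \bigcup_i [set` I i].
  move=> v; rewrite /= in_itv /= => /Aphi[x /AU[i _ Ux] <-].
  exists i => //=; rewrite in_itv /=; apply/andP; split.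
    apply: ge_inf; last by exists x.
    by exists (phi x - d i)%R => _ [y Uy <-]; exact: Uphi.
  rewrite -lerBlDr; apply: lb_le_inf; first by exists (phi x); exists x.
  by move=> _ [y Uy <-]; exact: Uphi.
have le_sum : lebesgue_measure ([set` `[a, b]%R] : set R) <=
    \sum_(0 <= i <oo) lebesgue_measure ([set` I i] : set R).
  exact: (measure_sigma_subadditive (@lebesgue_measure R)
    (fun i => measurable_itv (I i)) (measurable_itv `[a, b]%R) cover).
rewrite lebesgue_measure_itv /= in le_sum.
apply: (@le_trans _ _ (if a%:E < b%:E then b%:E - a%:E else 0)).
  by rewrite lte_fin -EFinB; case: ifPn => //; rewrite lee_fin; lra.
apply: le_trans le_sum _; apply: lee_nneseries => // i _.
rewrite lebesgue_measure_itv /= -EFinB dE lte_fin; case: ifP => _.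
  by rewrite lee_fin; lra.
by rewrite -dE ediam_ge0.
Qed.

End HausdorffMeasure.

(** * Length of Lipschitz images of the unit interval *)

Section LipschitzImages.
Context {R : realType}.
Implicit Types (f : R -> R * R) (L t : R) (n : nat).

Lemma unit_itv_cell n t : 0 <= t -> t <= 1 ->
  exists2 i : nat, (i < n.+1)%N & i%:R / n.+1%:R <= t <= i.+1%:R / n.+1%:R.
Proof.
move=> t0 t1; have n0 : 0 < n.+1%:R :> R by rewrite ltr0n.
suff H m : t <= m.+1%:R / n.+1%:R ->
    exists2 i : nat, (i < m.+1)%N & i%:R / n.+1%:R <= t <= i.+1%:R / n.+1%:R.
  by apply: H; rewrite divff ?gt_eqF.
elim: m => [|m IH] tm; first by exists 0%N => //; rewrite mul0r t0.
case: (leP t (m.+1%:R / n.+1%:R)) => [/IH[i im Hi]|/ltW mt].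
  by exists i => //; exact: leqW.
by exists m.+1 => //; rewrite mt.
Qed.

(** The images of [n + 1] equal cells have diameter at most [L / (n + 1)], which is below the scale
    [d] for large [n], and these bounds add up to [L]. *)
Lemma hausdorff1_lipschitz f L : 0 <= L ->
  (forall s t, s \in `[0, 1] -> t \in `[0, 1] ->
     edist (f s) (f t) <= L * `|s - t|) ->
  (hausdorff1 (f @` `[0%R, 1%R]) <= L%:E)%E.
Proof.
move=> L0 fL; apply: hausdorff1_le => d d0.
pose n := Num.truncn (L / d); have n0 : 0 < n.+1%:R :> R by rewrite ltr0n.
have Lnd : L / n.+1%:R <= d.
  rewrite ler_pdivrMr // mulrC -ler_pdivrMr //.
  by rewrite ltW // truncnS_gt.
(* Empty sets, of diameter 0, pad the finite cover to a sequence. *)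
pose U i := if (i < n.+1)%N then
  f @` [set t | t \in `[0, 1] /\ i%:R / n.+1%:R <= t <= i.+1%:R / n.+1%:R]
  else set0.
have cover : f @` `[0, 1] `<=` \bigcup_i U i.
  move=> _ [t t01 <-]; move: (t01); rewrite /= in_itv /= => /andP[t0 t1].
  have [i ilt Hi] := unit_itv_cell n t0 t1.
  by exists i => //; rewrite /U ilt; exists t.
have Udiam i : (i < n.+1)%N -> (ediam (U i) <= (L / n.+1%:R)%:E)%E.
  move=> ilt; apply: ediam_le; first by rewrite divr_ge0.
  rewrite /U ilt => _ _ [s [s01 Hs] <-] [t [t01 Ht] <-].
  rewrite (le_trans (fL _ _ s01 t01)) // ler_wpM2l //.
  have -> : n.+1%:R^-1 = i.+1%:R / n.+1%:R - i%:R / n.+1%:R :> R.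
    by rewrite -mulrBl -natrB // subSnn mul1r.
  move: Hs Ht; set u := _ / _; set v := _ / _ => /andP[? ?] /andP[? ?].
  by rewrite ler_norml; lra.
have U0 i : (n.+1 <= i)%N -> ediam (U i) = 0%E.
  by move=> ni; rewrite /U ltnNge ni; exact: ediam0.
have Ud i : (ediam (U i) <= d%:E)%E.
  case: (ltnP i n.+1) => [/Udiam/le_trans|/U0 ->]; last by rewrite lee_fin ltW.
  by apply; rewrite lee_fin.
rewrite (le_trans (hausdorff1_delta_le_cover cover Ud)) //.
rewrite (nneseries_split 0 n.+1); last by move=> *; exact: ediam_ge0.
rewrite [X in (_ + X)%E]eseries0 ?adde0; last by move=> i /= ni _; apply: U0.
rewrite add0n (@le_trans _ _ (\sum_(0 <= i < n.+1) (L / n.+1%:R)%:E)%E) //.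
  rewrite !big_nat; apply: lee_sum => i /= ilt; exact: Udiam.
rewrite sumEFin lee_fin big_const_nat iter_addr_0 subn0 -[_ *+ _]mulr_natr.
by rewrite divfK // gt_eqF.
Qed.

End LipschitzImages.

(** * Rectifiable curves: arcs, unions, crossings and separation *)

Section RectifiableCurves.
Context {R : realType}.
Implicit Types (f g : R -> R * R) (h : R -> R) (A B K G : set (R * R)).
Implicit Types (L a b s t : R) (x y : R * R).

Lemma lipschitz01_nneg f : lipschitz01 f -> exists2 L : R, 0 <= L &
  forall s t, s \in `[0, 1] -> t \in `[0, 1] ->
    edist (f s) (f t) <= L * `|s - t|.
Proof.
move=> [L fL]; exists `|L| => // s t s01 t01.
by rewrite (le_trans (fL _ _ s01 t01)) // ler_wpM2r // ler_norm.
Qed.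

Lemma rectifiable_curve_fin G : rectifiable_curve G -> (hausdorff1 G < +oo)%E.
Proof.
move=> [f [/lipschitz01_nneg[L L0 fL] ->]].
by rewrite (le_lt_trans (hausdorff1_lipschitz L0 fL)) // ltry.
Qed.

Lemma rectifiable_curve_arc f a b : lipschitz01 f -> 0 <= a -> a <= b -> b <= 1 ->
  rectifiable_curve (f @` `[a, b]).
Proof.
move=> /lipschitz01_nneg[L L0 fL] a0 ab b1.
have in01 (u : R) : u \in `[0, 1] -> a + u * (b - a) \in `[0, 1].
  by rewrite !in_itv /= => /andP[u0 u1]; apply/andP; split; nra.
exists (fun u => f (a + u * (b - a))); split.
  exists L => s t s01 t01; rewrite (le_trans (fL _ _ (in01 _ s01) (in01 _ t01))) //.
  rewrite ler_wpM2l //.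
  have -> : a + s * (b - a) - (a + t * (b - a)) = (s - t) * (b - a) by ring.
  by rewrite normrM ler_piMr // ger0_norm; lra.
apply/seteqP; split => [_ [t tab <-]|_ [u /= u01 <-]].
  move: tab; rewrite /= in_itv /= => /andP[at_ tb].
  have [ba|ba] := eqVneq b a.
    exists 0; first by rewrite /= in_itv /= lexx ler01.
    by congr f; lra.
  have ba0 : 0 < b - a by rewrite subr_gt0 lt_neqAle eq_sym ba ab.
  exists ((t - a) / (b - a)); last by rewrite divfK ?gt_eqF //; congr f; ring.
  rewrite /= in_itv /= divr_ge0 ?ler_pdivrMr //=; lra.
exists (a + u * (b - a)) => //.
by move: u01; rewrite /= !in_itv /= => /andP[u0 u1]; apply/andP; split; nra.
Qed.

Definition line_path x y t : R * R :=
  (x.1 + t * (y.1 - x.1), x.2 + t * (y.2 - x.2)).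

Definition line_segment x y : set (R * R) := line_path x y @` `[0, 1].

Lemma edist_line_path x y s t :
  edist (line_path x y s) (line_path x y t) = edist x y * `|s - t|.
Proof.
rewrite /edist /= -[`|s - t|]sqrtr_sqr -sqrtrM ?addr_ge0 ?sqr_ge0 //.
by congr Num.sqrt; ring.
Qed.

Lemma rectifiable_line_segment x y : rectifiable_curve (line_segment x y).
Proof.
by exists (line_path x y); split => //; exists (edist x y) => *; rewrite edist_line_path.
Qed.

Lemma hausdorff1_line_segment x y : (hausdorff1 (line_segment x y) <= (edist x y)%:E)%E.
Proof.
apply: (@hausdorff1_lipschitz _ (line_path x y)) => [|s t _ _].
  exact: edist_ge0.
by rewrite edist_line_path.
Qed.

Lemma line_segment_start x y : line_segment x y x.
Proof.
exists 0; first by rewrite /= in_itv /= lexx ler01.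
by rewrite /line_path !mul0r !addr0 -surjective_pairing.
Qed.

Lemma line_segment_end x y : line_segment x y y.
Proof.
exists 1; first by rewrite /= in_itv /= lexx ler01.
by rewrite /line_path !mul1r ![_ + (_ - _)]addrC !subrK -surjective_pairing.
Qed.

(* Precomposition with the triangle wave [u |-> |1 - |s + 2 u - 1||] sweeps
   [0, 1] once up and once down, starting and ending at [s]. *)
Lemma rectifiable_curve_loop G x : rectifiable_curve G -> G x ->
  exists f, [/\ lipschitz01 f, G = f @` `[0, 1], f 0 = x & f 1 = x].
Proof.
move=> [f [/lipschitz01_nneg[L L0 fL] ->]] [s s01 <-].
move: (s01); rewrite /= in_itv /= => /andP[s0 s1].
pose w u := `|1 - `|s + u *+ 2 - 1| |.
have w01 (u : R) : u \in `[0, 1] -> w u \in `[0, 1].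
  rewrite !in_itv /= => /andP[u0 u1]; rewrite normr_ge0 /=.
  have : `|s + u *+ 2 - 1| <= 2 by rewrite ler_norml mulr2n; lra.
  by move: (normr_ge0 (s + u *+ 2 - 1)) => ? ?; rewrite ler_norml; lra.
have wE (u : R) : u = 0 \/ u = 1 -> w u = s.
  rewrite /w mulr2n => -[]->.
    have -> : `|s + (0 + 0) - 1| = 1 - s by rewrite ler0_norm; lra.
    by rewrite ger0_norm; lra.
  have -> : `|s + (1 + 1) - 1| = 1 + s by rewrite ger0_norm; lra.
  by rewrite ler0_norm; lra.
exists (f \o w); split => /=; try by rewrite wE; auto.
  exists (L * 2) => u v u01 v01; rewrite (le_trans (fL _ _ (w01 _ u01) (w01 _ v01))) //.
  rewrite -mulrA ler_wpM2l // (le_trans (ler_dist_dist _ _)) //.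
  have -> : 1 - `|s + u *+ 2 - 1| - (1 - `|s + v *+ 2 - 1|) =
            `|s + v *+ 2 - 1| - `|s + u *+ 2 - 1| by ring.
  rewrite (le_trans (ler_dist_dist _ _)) //.
  have -> : s + v *+ 2 - 1 - (s + u *+ 2 - 1) = 2 * (v - u) by rewrite !mulr2n; ring.
  by rewrite normrM ger0_norm // distrC.
apply/seteqP; split => [_ [y y01 <-]|_ [u u01 <-]]; last by exists (w u) => //; exact: w01.
move: (y01); rewrite /= in_itv /= => /andP[y0 y1].
exists ((2 - y - s) / 2); first by rewrite /= in_itv /=; lra.
rewrite /w; congr f; have -> : s + ((2 - y - s) / 2) *+ 2 - 1 = 1 - y.
  by rewrite -mulr_natr; field.
have -> : `|1 - y| = 1 - y by rewrite ger0_norm; lra.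
by rewrite ger0_norm; lra.
Qed.

(** Both curves are parametrized as loops based at a common point [x], and the loops are run one
    after the other at double speed. *)
Lemma rectifiable_curveU A B : rectifiable_curve A -> rectifiable_curve B ->
  A `&` B !=set0 -> rectifiable_curve (A `|` B).
Proof.
move=> cA cB [x [Ax Bx]].
have [f [/lipschitz01_nneg[L L0 fL] -> _ f1]] := rectifiable_curve_loop cA Ax.
have [g [/lipschitz01_nneg[M M0 gM] -> g0 _]] := rectifiable_curve_loop cB Bx.
pose h u := if u <= 2^-1 then f (2 * u) else g (2 * u - 1).
pose c := (L + M) * 2.
have half0 : 0 < 2^-1 :> R by rewrite invr_gt0.
have I01 (u : R) : u \in `[0, 1] -> 0 <= u /\ u <= 1 by rewrite in_itv /= => /andP[].
have mem01 (u : R) : 0 <= u -> u <= 1 -> u \in `[0, 1] by move=> ? ?; rewrite in_itv /=; lra.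
have half (s : R) : (s <= 2^-1) = (2 * s <= 1) by apply/idP/idP; lra.
have hl s t : s \in `[0, 1] -> t \in `[0, 1] -> s <= t ->
    edist (h s) (h t) <= c * (t - s).
  move=> /I01[s0 s1] /I01[t0 t1] st; rewrite /h /c !half.
  case: (leP (2 * s) 1) => s2; case: (leP (2 * t) 1) => t2.
  - rewrite (le_trans (fL _ _ _ _)) ?mem01 //; try lra.
    by rewrite ler0_norm; nra.
  (* Across the junction, the path is compared with the base point [x], which is both [f 1] and
     [g 0]. *)
  - rewrite (le_trans (edist_triangle x _ _)) //.
    have H1 : edist (f (2 * s)) x <= L * (1 - 2 * s).
      rewrite -{1}f1 (le_trans (fL _ _ _ _)) ?mem01 //; try lra.
      by rewrite ler0_norm; nra.
    have H2 : edist x (g (2 * t - 1)) <= M * (2 * t - 1).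
      rewrite -{1}g0 (le_trans (gM _ _ _ _)) ?mem01 //; try lra.
      by rewrite ler0_norm; nra.
    nra.
  - by lra.
  - rewrite (le_trans (gM _ _ _ _)) ?mem01 //; try lra.
    by rewrite ler0_norm; nra.
exists h; split.
  exists c => s t s01 t01; case: (leP s t) => st.
    by rewrite ler0_norm ?subr_le0 // opprB hl.
  by rewrite edistC gtr0_norm ?subr_gt0 // hl // ltW.
apply/seteqP; split => [_ [[u /I01[u0 u1] <-]|[u /I01[u0 u1] <-]]|_ [u /I01[u0 u1] <-]].
- exists (u / 2); first by apply: mem01; lra.
  by rewrite /h half mulrCA divff // mulr1 u1.
(* At time 1/2 the map [h] still follows [f], so the point [g 0] has to be recovered as [f 1]. *)
- have [u00|un0] := eqVneq u 0.
    exists 2^-1; first by apply: mem01; lra.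
    by rewrite /h half divff // lexx f1 u00 g0.
  have u0' : 0 < u by rewrite lt_neqAle eq_sym un0.
  exists ((u + 1) / 2); first by apply: mem01; lra.
  rewrite /h half mulrCA divff // mulr1 ifF ?addrK //.
  by apply/negbTE; rewrite -ltNge; lra.
- rewrite /h half; case: (leP (2 * u) 1) => u2; [left|right].
    by exists (2 * u) => //; apply: mem01; lra.
  by exists (2 * u - 1) => //; apply: mem01; lra.
Qed.

Lemma lipschitz_within_continuous h L a b : 0 <= L ->
  (forall s t, s \in `[a, b] -> t \in `[a, b] -> `|h s - h t| <= L * `|s - t|) ->
  {within `[a, b], continuous h}.
Proof.
move=> L0 hL; apply/subspace_continuousP => t tab.
apply/cvgrPdist_le => e e0; rewrite near_withinE.
have L1 : 0 < L + 1 by lra.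
(* The denominator is [L + 1] because [L] may be 0. *)
apply/nbhs_ballP; exists (e / (L + 1)) => /=; first exact: divr_gt0.
move=> s; rewrite /ball /= ltr_pdivlMr // => ts sab.
rewrite (le_trans (hL _ _ tab sab)) //.
by have := normr_ge0 (t - s); nra.
Qed.

(** Translates continuity for the product topology, whose balls are squares: [e / 2] on each
    coordinate gives [e] for [edist]. *)
Lemma within_continuous_edist f a b t e : {within `[a, b], continuous f} ->
  t \in `[a, b] -> 0 < e ->
  exists2 d : R, 0 < d & forall s, s \in `[a, b] -> `|s - t| < d -> edist (f s) (f t) <= e.
Proof.
move=> /subspace_continuousP fc tab e0.
have e20 : 0 < e / 2 by rewrite divr_gt0.
have := fc _ tab; move/cvg_ballP => /(_ _ e20); rewrite near_withinE.
move=> /nbhs_ballP[d /= d0 Hd]; exists d => // s sab std.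
have [] : ball (f t) (e / 2) (f s) by apply: Hd => //; rewrite /ball /= distrC.
rewrite /ball /= => H1 H2; rewrite edistC (le_trans (edist_le_normD _ _)) //.
by rewrite [leRHS]splitr lerD // ltW.
Qed.

Lemma curve_ivt K (phi : R * R -> R) x y v : rectifiable_curve K ->
  (forall z w, `|phi z - phi w| <= edist z w) ->
  K x -> K y -> phi x <= v <= phi y -> exists2 z, K z & phi z = v.
Proof.
move=> [f [/lipschitz01_nneg[L L0 fL] ->]] phi_lip [s s01 <-] [t t01 <-] /andP[sv vt].
have cont a b : a \in `[0, 1] -> b \in `[0, 1] ->
    {within `[a, b], continuous (phi \o f)}.
  rewrite !in_itv /= => /andP[a0 a1] /andP[b0 b1].
  apply: (@lipschitz_within_continuous _ L) => // u w.
  rewrite !in_itv /= => /andP[? ?] /andP[? ?].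
  by rewrite (le_trans (phi_lip _ _)) // fL // in_itv /=; lra.
have I01 (a b c : R) : a \in `[0, 1] -> b \in `[0, 1] -> c \in `[a, b] -> c \in `[0, 1].
  by rewrite !in_itv /= => /andP[? ?] /andP[? ?] /andP[? ?]; lra.
have [st|/ltW ts] := leP s t.
  have [|c cst <-] := IVT st (cont _ _ s01 t01) (v := v).
    by rewrite /= ge_min sv le_max vt orbT.
  by exists (f c) => //; exists c => //; exact: I01 cst.
have [|c cst <-] := IVT ts (cont _ _ t01 s01) (v := v).
  by rewrite /= ge_min sv orbT le_max vt.
by exists (f c) => //; exists c => //; exact: I01 cst.
Qed.

(** The crossing is the supremum of the times at which [h] is at most [v]. *)
Lemma last_crossing h L a b v : 0 <= L -> a <= b ->
  (forall s t, s \in `[a, b] -> t \in `[a, b] -> `|h s - h t| <= L * `|s - t|) ->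
  h a <= v <= h b ->
  exists c, [/\ a <= c, c <= b, h c = v & forall t, c <= t -> t <= b -> v <= h t].
Proof.
move=> L0 ab hL /andP[av vb].
pose S := [set t | [/\ a <= t, t <= b & h t <= v]].
have Sa : S a by split.
have Sub : ubound S b by move=> t [].
have supS : has_sup S by split; [exists a|exists b].
have ac : a <= sup S by exact: ub_le_sup supS.2 _ Sa.
have cb : sup S <= b by apply: ge_sup => //; exists a.
have hc : h (sup S) <= v.
  apply/ler_addgt0Pr => e e0; have L1 : 0 < L + 1 by lra.
  have [t [at_ tb tv] ts] := sup_adherent (divr_gt0 e0 L1) supS.
  have tsup : t <= sup S by apply: ub_le_sup supS.2 _ _; split.
  have := hL (sup S) t; rewrite !in_itv /= ac cb at_ tb => /(_ isT isT).
  rewrite [`|sup S - t|]ger0_norm ?subr_ge0 //.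
  have : (sup S - t) * (L + 1) < e by rewrite -ltr_pdivlMr //; lra.
  by rewrite ler_norml => H /andP[_]; nra.
have cont : {within `[sup S, b], continuous h}.
  apply: lipschitz_within_continuous L0 _ => s t.
  rewrite !in_itv /= => /andP[s0 s1] /andP[t0 t1].
  by apply: hL; rewrite in_itv /= ?s1 ?t1 (le_trans ac).
have [|c] := IVT cb cont (v := v); first by rewrite ge_min hc le_max vb orbT.
rewrite in_itv /= => /andP[sc cb'] hcv.
(* A crossing found after [sup S] belongs to [S], so it is [sup S] itself and the value there is
   exactly [v]. *)
have cS : c = sup S.
  apply/eqP; rewrite eq_le sc andbT; apply: ub_le_sup supS.2 _ _.
  by split; rewrite ?hcv // (le_trans ac).
exists c; split => //; first by rewrite cS.
move=> t ct tb; rewrite leNgt; apply/negP => tv.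
have tS : t <= sup S.
  by apply: ub_le_sup supS.2 _ _; split => //; rewrite ?(ltW tv) // (le_trans ac) // -cS.
by have tc : t = c; [apply/eqP; rewrite eq_le ct cS tS|rewrite tc hcv ltxx in tv].
Qed.

(** Compactness in two steps: for fixed [s] the distance to the second curve is attained, and this
    distance is Lipschitz in [s], so its minimum is attained too. A zero minimum would give a common
    point. *)
Lemma curves_separated A B : rectifiable_curve A -> rectifiable_curve B ->
  A `&` B = set0 -> exists2 e : R, 0 < e & forall x y, A x -> B y -> e <= edist x y.
Proof.
move=> [f [/lipschitz01_nneg[L L0 fL] ->]] [g [/lipschitz01_nneg[M M0 gM] ->]] AB.
pose D s : set R := [set edist (f s) (g t) | t in `[0, 1]].
pose h s := inf (D s).
have I0 : (0 : R) \in `[0, 1] by rewrite in_itv /= lexx ler01.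
have Dne s : D s !=set0 by exists (edist (f s) (g 0)); exists 0.
have Dlb s : has_lbound (D s) by exists 0 => _ [t _ <-]; exact: edist_ge0.
have h_attained s : s \in `[0, 1] -> exists2 t, t \in `[0, 1] & h s = edist (f s) (g t).
  move=> s01; have cont : {within `[0, 1], continuous (fun t => edist (f s) (g t))}.
    apply: (@lipschitz_within_continuous _ M) => // u v u01 v01.
    have := edist_triangle (g v) (f s) (g u); have := edist_triangle (g u) (f s) (g v).
    by have := gM _ _ u01 v01; rewrite (edistC (g v)) ler_norml; lra.
  have [t t01 tmin] := EVT_min ler01 cont; exists t => //.
  apply/eqP; rewrite eq_le ge_inf //=; last by exists t.
  by apply: lb_le_inf => // _ [u u01 <-]; exact: tmin.
have hle s u : s \in `[0, 1] -> u \in `[0, 1] -> h s <= h u + L * `|s - u|.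
  move=> s01 u01; have [t t01 ->] := h_attained _ u01.
  apply: (@le_trans _ _ (edist (f s) (g t))); first by apply: ge_inf => //; exists t.
  by rewrite (le_trans (edist_triangle (f u) _ _)) // addrC lerD // fL.
have cont : {within `[0, 1], continuous h}.
  apply: (@lipschitz_within_continuous _ L) => // u v u01 v01.
  have := hle _ _ u01 v01; have := hle _ _ v01 u01.
  by rewrite (distrC v) ler_norml; lra.
have [s s01 smin] := EVT_min ler01 cont.
have [t t01 st] := h_attained _ s01.
exists (h s); last first.
  move=> _ _ [u u01 <-] [v v01 <-]; rewrite (le_trans (smin u u01)) //.
  by apply: ge_inf => //; exists v.
rewrite st lt_neqAle edist_ge0 andbT; apply/negP => /eqP d0.
have fg : f s = g t.
  have := norm_fst_le_edist (f s) (g t); have := norm_snd_le_edist (f s) (g t).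
  rewrite -d0 !normr_le0 !subr_eq0 => /eqP H2 /eqP H1.
  by rewrite [LHS]surjective_pairing H1 H2 -surjective_pairing.
have : ((f @` `[0, 1]) `&` (g @` `[0, 1])) (f s) by split; [exists s|exists t].
by rewrite AB.
Qed.

(** Follow a path in [E] from a point near [A] to a point near [B]. Just after the supremum of the
    times spent near [A], the path has to be near [B]; crossing that instant costs [e] on each
    side. *)
Lemma path_connected_chain (E A B : set (R * R)) d e : path_connected E -> 0 < e ->
  (forall z, E z -> (exists2 x, A x & edist x z < d) \/ (exists2 y, B y & edist y z < d)) ->
  (exists2 z, E z & exists2 x, A x & edist x z < d) ->
  (exists2 z, E z & exists2 y, B y & edist y z < d) ->
  exists x y, [/\ A x, B y & edist x y <= d *+ 2 + e *+ 2].
Proof.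
move=> Econn e0 cover [z1 Ez1 Az1] [z2 Ez2 Bz2].
have [g [gc g0 g1 gE]] := Econn _ _ Ez1 Ez2.
pose S := [set t | [/\ 0 <= t, t <= 1 & exists2 x, A x & edist x (g t) < d]].
have S0 : S 0 by split => //; rewrite g0.
have supS : has_sup S by split; [exists 0|exists 1 => t []].
have c0 : 0 <= sup S by exact: ub_le_sup supS.2 _ S0.
have c1 : sup S <= 1 by apply: ge_sup => [|t []//]; exists 0.
have [|del del0 gdel] := within_continuous_edist gc _ e0 (t := sup S).
  by rewrite in_itv /= c0 c1.
have [t [t0 t1 [x Ax xt]] ts] := sup_adherent del0 supS.
have tsup : t <= sup S by apply: ub_le_sup supS.2 _ _; split => //; exists x.
pose u := Num.min 1 (sup S + del / 2).
have su : sup S <= u by rewrite le_min c1; lra.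
have u1 : u <= 1 by rewrite ge_min lexx.
have udel : u <= sup S + del / 2 by rewrite ge_min lexx orbT.
have Eu : E (g u) by apply: gE; exists u => //; rewrite /= in_itv /=; lra.
have [y By yu] : exists2 y, B y & edist y (g u) < d.
  have [->|un1] := eqVneq u 1; first by rewrite g1.
  case: (cover _ Eu) => // Au.
  have uS : u <= sup S by apply: ub_le_sup supS.2 _ _; split => //; lra.
  exfalso; move: un1 uS; rewrite /u; case: (leP 1 (sup S + del / 2)) => _.
    by rewrite eqxx.
  by move=> _; lra.
exists x, y; split => //.
have H1 : edist (g t) (g (sup S)) <= e.
  by apply: gdel; rewrite ?in_itv /= ?t0 // ler0_norm; lra.
have H2 : edist (g u) (g (sup S)) <= e.
  by apply: gdel; rewrite ?in_itv /= ?u1 ?(le_trans c0) // ger0_norm; lra.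
have := edist_triangle (g t) x y; have := edist_triangle (g (sup S)) (g t) y.
have := edist_triangle (g u) (g (sup S)) y.
by rewrite !mulr2n (edistC (g (sup S)) (g u)) (edistC (g u) y); lra.
Qed.

End RectifiableCurves.

(** * Finite families of curves: merging, adding lengths, reconnecting *)

Section CurveFamilies.
Context {R : realType}.
Implicit Types (s t : seq (set (R * R))) (A B K G E W : set (R * R)).

Definition family_union s : set (R * R) := [set x | exists2 K, List.In K s & K x].

(** Members are compared by position, so no nonempty set occurs twice and [size] really counts
    pieces. *)
Fixpoint pairwise_disjoint s : Prop :=
  if s is K :: s' then
    (forall K', List.In K' s' -> K `&` K' = set0) /\ pairwise_disjoint s'
  else True.

Lemma family_union_cons K s : family_union (K :: s) = K `|` family_union s.
Proof.
apply/seteqP; split => [x [A [<-|As] Ax]|x [Kx|[A As Ax]]].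
- by left.
- by right; exists A.
- by exists K => //; left.
- by exists A => //; right.
Qed.

(** [K] absorbs each member that it meets; the enlarged set is then inserted into the remaining
    members, as it may meet more of them. *)
Lemma disjoint_insert (P : set (R * R) -> Prop) s K :
  (forall A B, P A -> P B -> A `&` B !=set0 -> P (A `|` B)) ->
  (forall A, List.In A s -> P A) -> pairwise_disjoint s -> P K ->
  exists t, [/\ forall A, List.In A t -> P A, pairwise_disjoint t, t <> [::] &
                family_union t = K `|` family_union s].
Proof.
move=> PU; elim: s K => [|B s IH] K Ps.
  move=> _ PK; exists [:: K]; split => //; first by move=> A [<-|].
  by rewrite family_union_cons.
move=> [Bs disj] PK; have Ps' A : List.In A s -> P A by move=> As; apply: Ps; right.
have PB : P B by apply: Ps; left.
have [KB0|] := pselect (K `&` B = set0); last first.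
  move/eqP/set0P => KB; have [t [Pt tdisj tne tU]] := IH _ Ps' disj (PU _ _ PK PB KB).
  by exists t; split => //; rewrite tU family_union_cons setUA.
have [t [Pt tdisj tne tU]] := IH _ Ps' disj PK.
exists (B :: t); split => //.
- by move=> A [<-|/Pt].
(* The shape of [t] is unknown, but its union is [K] together with the union of [s], both disjoint
   from [B]. *)
- split => // A At; rewrite -subset0 => x [Bx Ax].
  have : (K `|` family_union s) x by rewrite -tU; exists A.
  move=> [Kx|[A' A's A'x]]; first by have : (K `&` B) x by []; rewrite KB0.
  by have : (B `&` A') x by []; rewrite Bs.
- by rewrite !family_union_cons tU setUCA.
Qed.

Lemma disjoint_merge (P : set (R * R) -> Prop) s :
  (forall A B, P A -> P B -> A `&` B !=set0 -> P (A `|` B)) ->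
  (forall A, List.In A s -> P A) ->
  exists t, [/\ forall A, List.In A t -> P A, pairwise_disjoint t &
                family_union t = family_union s].
Proof.
move=> PU; elim: s => [|K s IH] Ps; first by exists [::].
have [t [Pt tdisj tU]] : exists t, [/\ forall A, List.In A t -> P A,
    pairwise_disjoint t & family_union t = family_union s].
  by apply: IH => A As; apply: Ps; right.
have [|t' [Pt' t'disj _ t'U]] := disjoint_insert (K := K) PU Pt tdisj.
  by apply: Ps; left.
by exists t'; split => //; rewrite t'U tU family_union_cons.
Qed.

Lemma family_separated A s : rectifiable_curve A ->
  (forall K, List.In K s -> rectifiable_curve K) ->
  (forall K, List.In K s -> A `&` K = set0) ->
  exists2 e : R, 0 < e & forall x y, A x -> family_union s y -> e <= edist x y.
Proof.
move=> cA; elim: s => [|K s IH] cs ds; first by exists 1 => // x y _ [].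
have [e e0 He] : exists2 e : R, 0 < e &
    forall x y, A x -> family_union s y -> e <= edist x y.
  by apply: IH => B Bs; [apply: cs; right|apply: ds; right].
have [d d0 Hd] := curves_separated cA (cs K (or_introl erefl)) (ds K (or_introl erefl)).
exists (Num.min d e); first by rewrite lt_min d0.
move=> x y Ax; rewrite family_union_cons ge_min => -[Ky|sy].
  by rewrite Hd.
by rewrite He ?orbT.
Qed.

(** Disjoint curves are at positive distance by compactness, so the lengths of their traces on [W]
    add up. *)
Lemma hausdorff1_disjoint_family s W (l : R) :
  (forall K, List.In K s -> rectifiable_curve K) -> pairwise_disjoint s ->
  (forall K, List.In K s -> (l%:E <= hausdorff1 (K `&` W))%E) ->
  (((size s)%:R * l)%:E <= hausdorff1 (family_union s `&` W))%E.
Proof.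
elim: s => [|K s IH] cs.
  by move=> _ _; rewrite mul0r hausdorff1_ge0.
move=> [Ks disj] ls.
have cs' A : List.In A s -> rectifiable_curve A by move=> As; apply: cs; right.
have [e e0 He] := family_separated (cs K (or_introl erefl)) cs' Ks.
rewrite family_union_cons setIUl /= -natr1 mulrDl mul1r addrC EFinD.
apply: (@le_trans _ _ (hausdorff1 (K `&` W) + hausdorff1 (family_union s `&` W))%E).
  rewrite leeD //; first by apply: ls; left.
  by apply: IH => // A As; apply: ls; right.
by apply: (hausdorff1_separated e0) => x y [Kx _] [sy _]; exact: He.
Qed.

Lemma family_curveU s G : rectifiable_curve G ->
  (forall K, List.In K s -> rectifiable_curve K /\ K `&` G !=set0) ->
  rectifiable_curve (family_union s `|` G).
Proof.
move=> cG; elim: s => [|K s IH] cs.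
  by rewrite (_ : family_union [::] = set0) ?set0U // -subset0 => x [].
have [cK [x [Kx Gx]]] := cs K (or_introl erefl).
rewrite family_union_cons -setUA; apply: rectifiable_curveU => //.
  by apply: IH => A As; apply: cs; right.
by exists x; split => //; right.
Qed.

(* If [K] and the rest of the family were far apart, their neighbourhoods would
   disconnect [E]; so [K] can be joined to another member by a short segment,
   and one recurses on a family with one member less. *)
Lemma family_connect E (d e : R) s K : path_connected E -> 0 < e -> 0 <= d ->
  (forall A, List.In A (K :: s) -> rectifiable_curve A) ->
  (forall A, List.In A (K :: s) -> exists2 z, E z & exists2 x, A x & edist x z < d) ->
  (forall z, E z -> exists2 x, family_union (K :: s) x & edist x z < d) ->
  exists G, [/\ rectifiable_curve G, family_union (K :: s) `<=` G &
    (hausdorff1 G <= hausdorff1 (family_union (K :: s)) +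
                     ((size s)%:R * (d *+ 2 + e *+ 2))%:E)%E].
Proof.
move=> Econn e0 d0; set c := d *+ 2 + e *+ 2.
have [n] := ubnP (size s); elim: n => // n IH in s K *; rewrite ltnS => sn cs near cover.
have cK := cs K (or_introl erefl).
case: s => [|B s] in sn cs near cover *.
  have -> : family_union [:: K] = K.
    rewrite family_union_cons (_ : family_union [::] = set0) ?setU0 //.
    by rewrite -subset0 => x [].
  by exists K; split => //; rewrite mul0r adde0.
have [x [y [Kx [A As Ay] xy]]] : exists x y,
    [/\ K x, family_union (B :: s) y & edist x y <= c].
  apply: (path_connected_chain Econn e0).
  - move=> z /cover[x]; rewrite family_union_cons => -[Kx|sx] xz; [left|right];
    by exists x.
  - by apply: near; left.
  - have [z Ez [x Bx xz]] := near B (or_intror (or_introl erefl)).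
    by exists z => //; exists x => //; exists B => //; left.
have [s1 [s2 sE]] := List.in_split _ _ As.
have cA : rectifiable_curve A by apply: cs; right.
(* [M] takes the place of both [K] and [A]: one member less for one segment of length at most
   [c]. *)
pose S := line_segment x y; pose M := K `|` S `|` A.
have in_s D : List.In D (s1 ++ s2)%list -> List.In D (B :: s).
  rewrite sE => /(List.in_app_or _ _ _)[?|?]; apply: List.in_or_app; first by left.
  by right; right.
have cM : rectifiable_curve M.
  apply: rectifiable_curveU => //.
    apply: rectifiable_curveU => //; first exact: rectifiable_line_segment.
    by exists x; split => //; exact: line_segment_start.
  by exists y; split => //; right; exact: line_segment_end.
have sub z : family_union (K :: B :: s) z -> family_union (M :: (s1 ++ s2)%list) z.
  rewrite family_union_cons sE => -[Kz|[D /(List.in_app_or _ _ _)[Ds|[<-|Ds]] Dz]].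
  - by exists M; [left|left; left].
  - by exists D => //; right; apply: List.in_or_app; left.
  - by exists M; [left|right].
  - by exists D => //; right; apply: List.in_or_app; right.
have sizeE : size (B :: s) = (size (s1 ++ s2)%list).+1.
  by rewrite sE -!/(cat _ _) !size_cat /= addnS.
have [| | | |G [cG subG HG]] := IH (s1 ++ s2)%list M.
- by move: sn; rewrite sizeE.
- by move=> D [<-//|/in_s ?]; apply: cs; right.
- move=> D [<-|/in_s ?]; last by apply: near; right.
  have [z Ez [w Kw wz]] := near K (or_introl erefl).
  by exists z => //; exists w => //; left; left.
- by move=> z /cover[w /sub ? ?]; exists w.
exists G; split => //; first by move=> z /sub/subG.
apply: le_trans HG _.
(* Only the segment [S] is new, so the total length grows by at most [c]. *)
have sup : family_union (M :: (s1 ++ s2)%list) `<=` family_union (K :: B :: s) `|` S.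
  move=> z [D [<-|/in_s Ds]] => [[[Kz|Sz]|Az]|Dz]; try by right.
  - by left; exists K => //; left.
  - by left; exists A => //; right.
  - by left; exists D => //; right.
have HS : (hausdorff1 S <= c%:E)%E.
  by rewrite (le_trans (hausdorff1_line_segment x y)) // lee_fin.
have -> : (size (B :: s))%:R * c = c + (size (s1 ++ s2)%list)%:R * c.
  by rewrite sizeE -natr1 mulrDl mul1r addrC.
rewrite EFinD addeA leeD2r //.
rewrite (le_trans (hausdorff1_subset sup)) // (le_trans (hausdorff1U _ _)) //.
by rewrite leeD2l.
Qed.

End CurveFamilies.

(** * Decomposition of a curve above a level *)

Section CurvePieces.
Context {R : realType}.
Implicit Types (f : R -> R * R) (K : set (R * R)) (x : R * R).

(** At time [u] the curve is at or below the level [rho]. The cell [[a, b]] is extended towards [u]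
    up to the crossing nearest to it; in between, the curve stays above the level. *)
Lemma curve_piece_of_cell f (phi : R * R -> R) (a b u rho : R) : lipschitz01 f ->
  (forall x y, `|phi x - phi y| <= edist x y) ->
  0 <= u <= 1 -> phi (f u) <= rho ->
  0 <= a -> a <= b -> b <= 1 -> (forall t, a <= t <= b -> rho <= phi (f t)) ->
  exists K, [/\ rectifiable_curve K, K `<=` f @` `[0, 1], f @` `[a, b] `<=` K,
    forall x, K x -> rho <= phi x & exists2 x, K x & phi x = rho].
Proof.
move=> fLip phiL /andP[u0 u1] fu a0 ab b1 abrho.
have [L L0 fL] := lipschitz01_nneg fLip.
have hL s t : s \in `[0, 1] -> t \in `[0, 1] ->
    `|phi (f s) - phi (f t)| <= L * `|s - t|.
  by move=> s01 t01; rewrite (le_trans (phiL _ _)) // fL.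
have arc a' b' c : 0 <= a' -> a' <= a -> b <= b' -> b' <= 1 ->
    (forall t, a' <= t <= b' -> rho <= phi (f t)) ->
    a' <= c <= b' -> phi (f c) = rho ->
  exists K, [/\ rectifiable_curve K, K `<=` f @` `[0, 1], f @` `[a, b] `<=` K,
    forall x, K x -> rho <= phi x & exists2 x, K x & phi x = rho].
  move=> a'0 a'a bb' b'1 Hrho cI fc; exists (f @` `[a', b']); split.
  - by apply: rectifiable_curve_arc => //; lra.
  - apply: image_subset => t; rewrite /= !in_itv /= => /andP[? ?].
    by apply/andP; split; lra.
  - apply: image_subset => t; rewrite /= !in_itv /= => /andP[? ?].
    by apply/andP; split; lra.
  - by move=> _ [t + <-]; rewrite /= in_itv /=; exact: Hrho.
  - by exists (f c) => //; exists c => //; rewrite /= in_itv.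
have ra : rho <= phi (f a) by apply: abrho; rewrite lexx.
have rb : rho <= phi (f b) by apply: abrho; rewrite lexx ab.
have [ua|au] := leP u a.
  have [||c [uc ca fc crho]] := @last_crossing _ (phi \o f) L u a rho L0 ua.
  - move=> s t; rewrite !in_itv /= => /andP[? ?] /andP[? ?].
    by apply: hL; rewrite in_itv /=; apply/andP; split; lra.
  - by rewrite fu ra.
  apply: (arc c b c) => //; try lra.
  - move=> t /andP[ct tb]; have [ta|at_] := leP t a; first exact: crho.
    by apply: abrho; rewrite ltW.
(* Reversing time turns the first crossing after [b] into a last crossing. *)
have [bu|ub] := leP b u.
  have [|||c [uc cb fc crho]] :=
      @last_crossing _ (fun t => phi (f (- t))) L (- u) (- b) rho L0.
  - by lra.
  - move=> s t; rewrite !in_itv /= => /andP[? ?] /andP[? ?].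
    rewrite (le_trans (hL _ _ _ _)) ?in_itv //=; try by apply/andP; split; lra.
    have -> : - s - - t = t - s by ring.
    by rewrite distrC.
  - by rewrite !opprK fu rb.
  apply: (arc a (- c) (- c)) => //; try lra.
  move=> t /andP[at_ tc]; have [tb|bt] := leP t b; first by apply: abrho; rewrite at_.
  by rewrite -[t]opprK; apply: crho; lra.
apply: (arc a b u) => //; rewrite ?(ltW au) ?(ltW ub) //.
by apply/eqP; rewrite eq_le fu abrho // !ltW.
Qed.

(* Cut [0, 1] into cells whose images have diameter less than [r]: a cell whose
   image meets [V] stays in [phi >= rho], and is extended to the nearest
   crossing of the level [rho]. *)
Lemma curve_pieces (G V : set (R * R)) (phi : R * R -> R) p (rho r : R) :
  rectifiable_curve G -> (forall x y, `|phi x - phi y| <= edist x y) ->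
  G p -> phi p <= rho -> 0 < r -> (forall x, V x -> rho + r <= phi x) ->
  exists2 s, forall K, List.In K s ->
    [/\ rectifiable_curve K, K `<=` G, forall x, K x -> rho <= phi x,
        exists2 x, K x & phi x = rho & exists2 x, K x & V x] &
    G `&` V `<=` family_union s.
Proof.
move=> [f [fLip ->]] phiL [u u01 <-] pu r0 Vrho.
have [L L0 fL] := lipschitz01_nneg fLip.
pose n := Num.truncn (L / r); have n0 : 0 < n.+1%:R :> R by rewrite ltr0n.
have Lnr : L / n.+1%:R <= r.
  by rewrite ler_pdivrMr // mulrC -ler_pdivrMr // ltW // truncnS_gt.
pose cell i : set R := [set t | i%:R / n.+1%:R <= t <= i.+1%:R / n.+1%:R].
have cell_width i s t : cell i s -> cell i t -> `|s - t| <= n.+1%:R^-1.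
  have -> : n.+1%:R^-1 = i.+1%:R / n.+1%:R - i%:R / n.+1%:R :> R.
    by rewrite -mulrBl -natrB // subSnn mul1r.
  rewrite /cell /=; set a := _ / _; set b := _ / _ => /andP[? ?] /andP[? ?].
  by rewrite ler_norml; lra.
have cell01 i t : (i < n.+1)%N -> cell i t -> t \in `[0, 1].
  move=> ilt /andP[it ti]; rewrite in_itv /= (le_trans _ it) ?divr_ge0 //=.
  by rewrite (le_trans ti) // ler_pdivrMr // mul1r ler_nat.
suff H m : (m <= n.+1)%N -> exists2 s, forall K, List.In K s ->
    [/\ rectifiable_curve K, K `<=` f @` `[0, 1], forall x, K x -> rho <= phi x,
        exists2 x, K x & phi x = rho & exists2 x, K x & V x] &
    forall i t, (i < m)%N -> cell i t -> V (f t) -> family_union s (f t).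
  have [s Hs cov] := H _ (leqnn n.+1); exists s => // _ [[t t01 <-] Vt].
  move: t01; rewrite /= in_itv /= => /andP[t0 t1].
  have [i ilt it] := unit_itv_cell n t0 t1; exact: cov it Vt.
elim: m => [|m IH] mn; first by exists [::].
have [s Hs cov] := IH (ltnW mn).
have [[t mt Vt]|noV] := pselect (exists2 t, cell m t & V (f t)); last first.
  exists s => // i t; rewrite ltnS leq_eqVlt => /predU1P[->|im] it Vt.
    by case: noV; exists t.
  exact: cov it Vt.
have mm : m%:R / n.+1%:R <= m.+1%:R / n.+1%:R :> R.
  by rewrite ler_pM2r ?invr_gt0 // ler_nat.
have [||||K [cK KG cellK Krho Kat]] := @curve_piece_of_cell f phi
    (m%:R / n.+1%:R) (m.+1%:R / n.+1%:R) u rho fLip phiL _ pu _ mm.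
- by move: u01; rewrite /= in_itv.
- exact: divr_ge0.
- by rewrite ler_pdivrMr // mul1r ler_nat.
- move=> v mv; have := Vrho _ Vt; have := phiL (f t) (f v).
  have := fL t v (cell01 _ _ mn mt) (cell01 _ _ mn mv).
  have := le_trans (ler_wpM2l L0 (cell_width _ _ _ mt mv)) Lnr.
  by rewrite ler_norml => ? ? /andP[? ?] ?; lra.
have inK v : cell m v -> K (f v) by move=> mv; apply: cellK; exists v; rewrite /= ?in_itv.
exists (K :: s).
  by move=> A [<-|/Hs//]; split => //; exists (f t) => //; exact: inK.
move=> i v; rewrite family_union_cons ltnS leq_eqVlt => /predU1P[->|im] iv Vv.
  by left; exact: inK.
by right; exact: cov iv Vv.
Qed.

End CurvePieces.

(** * The boundary of a square as a curve *)

Section SquareBoundary.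
Context {R : realType}.
Implicit Types (p x : R * R) (rho : R).

Lemma vertical_segmentP (a b c : R) x : a < b -> x.1 = c -> a <= x.2 <= b ->
  line_segment (c, a) (c, b) x.
Proof.
move=> ab xc /andP[ax xb]; exists ((x.2 - a) / (b - a)).
  by rewrite /= in_itv /= divr_ge0 ?ler_pdivrMr //=; lra.
rewrite /line_path /= subrr mulr0 addr0 divfK; last by rewrite gt_eqF // subr_gt0.
by rewrite addrC subrK -xc -surjective_pairing.
Qed.

Lemma horizontal_segmentP (a b c : R) x : a < b -> x.2 = c -> a <= x.1 <= b ->
  line_segment (a, c) (b, c) x.
Proof.
move=> ab xc /andP[ax xb]; exists ((x.1 - a) / (b - a)).
  by rewrite /= in_itv /= divr_ge0 ?ler_pdivrMr //=; lra.
rewrite /line_path /= subrr mulr0 addr0 divfK; last by rewrite gt_eqF // subr_gt0.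
by rewrite addrC subrK -xc -surjective_pairing.
Qed.

(** Four sides of length [2 * rho]. Left and top share a corner, bottom and right share another, and
    the two halves meet at the lower left corner. *)
Lemma sup_sphere_curve p rho : 0 < rho -> exists Q, [/\ rectifiable_curve Q,
  forall x, sup_dist p x = rho -> Q x & (hausdorff1 Q <= (8 * rho)%:E)%E].
Proof.
move=> rho0; pose c (i j : R) := (p.1 + i * rho, p.2 + j * rho).
pose S1 := line_segment (c (-1) (-1)) (c (-1) 1).
pose S2 := line_segment (c (-1) 1) (c 1 1).
pose S3 := line_segment (c (-1) (-1)) (c 1 (-1)).
pose S4 := line_segment (c 1 (-1)) (c 1 1).
exists (S1 `|` S2 `|` (S3 `|` S4)); split.
- have cS := @rectifiable_line_segment R.
  apply: rectifiable_curveU.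
  + apply: rectifiable_curveU; [exact: cS|exact: cS|exists (c (-1) 1)].
    by split; [exact: line_segment_end|exact: line_segment_start].
  + apply: rectifiable_curveU; [exact: cS|exact: cS|exists (c 1 (-1))].
    by split; [exact: line_segment_end|exact: line_segment_start].
  + by exists (c (-1) (-1)); split; left; exact: line_segment_start.
- move=> x xrho.
  have [x1 x2] : `|x.1 - p.1| <= rho /\ `|x.2 - p.2| <= rho.
    by rewrite -xrho /sup_dist !le_max !lexx orbT.
  have : (`|x.1 - p.1| == rho) || (`|x.2 - p.2| == rho).
    rewrite -[X in (_ == X) || _]xrho -[X in _ || (_ == X)]xrho /sup_dist.
    by case: (leP `|x.1 - p.1| `|x.2 - p.2|); rewrite eqxx ?orbT.
  move: x1 x2; rewrite !ler_norml => /andP[? ?] /andP[? ?].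
  rewrite !eqr_norml (ltW rho0) !andbT -!orbA => /or4P[] /eqP xE.
  + by right; right; apply: vertical_segmentP; lra.
  + by left; left; apply: vertical_segmentP; lra.
  + by left; right; apply: horizontal_segmentP; lra.
  + by right; left; apply: horizontal_segmentP; lra.
- have HS (u v : R * R) : edist u v <= 2 * rho ->
      (hausdorff1 (line_segment u v) <= (2 * rho)%:E)%E.
    by move=> uv; rewrite (le_trans (hausdorff1_line_segment u v)) // lee_fin.
  have H u v u' v' : edist (c u v) (c u' v') <= (`|u - u'| + `|v - v'|) * rho.
    rewrite (le_trans (edist_le_normD _ _)) //= mulrDl.
    have -> : p.1 + u * rho - (p.1 + u' * rho) = (u - u') * rho by ring.
    have -> : p.2 + v * rho - (p.2 + v' * rho) = (v - v') * rho by ring.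
    by rewrite !normrM (gtr0_norm rho0).
  have n0 : `|1 - 1 : R| = 0 by rewrite subrr normr0.
  have n0' : `|-1 - -1 : R| = 0 by rewrite subrr normr0.
  have n2 : `|-1 - 1 : R| = 2 by rewrite ler0_norm; lra.
  have -> : (8 * rho)%:E =
      ((2 * rho)%:E + (2 * rho)%:E + ((2 * rho)%:E + (2 * rho)%:E))%E :> \bar R.
    by rewrite -!EFinD; congr EFin; ring.
  rewrite (le_trans (hausdorff1U _ _)) // leeD //.
    rewrite (le_trans (hausdorff1U _ _)) // leeD //; apply: HS.
      by rewrite (le_trans (H _ _ _ _)) // n0' n2; lra.
    by rewrite (le_trans (H _ _ _ _)) // n0 n2; lra.
  rewrite (le_trans (hausdorff1U _ _)) // leeD //; apply: HS.
    by rewrite (le_trans (H _ _ _ _)) // n0' n2; lra.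
  by rewrite (le_trans (H _ _ _ _)) // n0 n2; lra.
Qed.

End SquareBoundary.

(** * Length comparisons for a minimizer *)

Section Minimizer.
Context {R : realType}.
Variables (E G : set (R * R)) (r : R) (p : R * R).
Hypotheses (E0 : E !=set0) (Econn : path_connected E) (r0 : 0 < r).
Hypotheses (Gmin : max_dist_minimizer (nbhd_closed E r) r G) (Gp : G p).

(** The part of the plane where [G] does its covering: a point of B(E, r) is within r of [E] and of
    [G], and 3 r leaves room for infima that are not attained. *)
Let near_E : set (R * R) := [set x | exists2 z, E z & edist x z < 3 * r].
Let ball_length (rho : R) : R := fine (hausdorff1 (G `&` [set x | sup_dist p x <= rho])).

Let cG : rectifiable_curve G. Proof. by case: Gmin. Qed.

Let fin_subset A : A `<=` G -> hausdorff1 A \is a fin_num.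
Proof.
move=> AG; rewrite ge0_fin_numE ?hausdorff1_ge0 //.
exact: le_lt_trans (hausdorff1_subset AG) (rectifiable_curve_fin cG).
Qed.

Let ball_lengthE rho :
  hausdorff1 (G `&` [set x | sup_dist p x <= rho]) = (ball_length rho)%:E.
Proof. by rewrite /ball_length fineK // fin_subset // => x []. Qed.

Let G_near z : E z -> exists2 x, G x & edist x z < 3 * r.
Proof.
move=> Ez; have [_ GE _] := Gmin.
have /GE zG : nbhd_closed E r z.
  by apply: nbhd_closed_near Ez _; rewrite edistxx ltW.
have [x Gx zx] := nbhd_closed_lt zG r0.
by exists x => //; rewrite edistC; move: r0 => ?; lra.
Qed.

(** A curve that keeps [near_E] unchanged still covers B(E, r), hence is an admissible
    competitor. *)
Let minimal H : rectifiable_curve H -> G `&` near_E `<=` H ->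
  (hausdorff1 G <= hausdorff1 H)%E.
Proof.
move=> cH GH; have [_ GE ->] := Gmin.
apply: ereal_inf_lbound; exists H => //; split => // x Ex.
apply: nbhd_closedP => e e0; pose d := Num.min e (r / 2).
have d0 : 0 < d by rewrite lt_min e0 divr_gt0.
have [de dr] : d <= e /\ d <= r / 2 by rewrite !ge_min !lexx orbT.
have [a Ga xa] := nbhd_closed_lt (GE _ Ex) d0.
have [z Ez xz] := nbhd_closed_lt Ex (divr_gt0 r0 (ltr0n R 2)).
exists a; last by lra.
apply: GH; split => //; exists z => //.
by have := edist_triangle x a z; rewrite (edistC a x); lra.
Qed.

Section Level.
Variables (rho' rho : R).
Hypotheses (rho'0 : 0 <= rho') (rho'rho : rho' < rho).
Hypothesis far : forall x, near_E x -> rho + r <= sup_dist p x.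

Let rho0 : 0 < rho. Proof. exact: le_lt_trans rho'rho. Qed.

(** Such a piece crosses the whole layer between [rho] and [rho + r], since [near_E] lies beyond
    it. *)
Let outer_piece K := [/\ rectifiable_curve K, K `<=` G,
  forall x, K x -> rho <= sup_dist p x,
  exists2 x, K x & sup_dist p x = rho & exists2 x, K x & near_E x].

Let pieces : exists2 s, forall K, List.In K s -> outer_piece K &
  G `&` near_E `<=` family_union s.
Proof.
have p_rho : sup_dist p p <= rho by rewrite sup_dist_self ltW.
exact: curve_pieces cG (sup_dist_lip p) Gp p_rho r0 far.
Qed.

(** The gap between [rho'] and [rho] keeps the pieces at positive distance from the content of the
    inner square. It is used with [W] the plane, for total lengths, and with [W] the square of
    half-side [rho + r]. *)
Let outer_inner_separated s (W : set (R * R)) :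
  (forall K, List.In K s -> outer_piece K) -> family_union s `&` W `|`
    G `&` [set x | sup_dist p x <= rho'] `<=` W ->
  (hausdorff1 (family_union s `&` W) + (ball_length rho')%:E <= hausdorff1 (G `&` W))%E.
Proof.
move=> Hs WW; rewrite -ball_lengthE.
have sep x y : (family_union s `&` W) x ->
    (G `&` [set x | sup_dist p x <= rho']) y -> rho - rho' <= edist x y.
  move=> [[K /Hs[_ _ Krho _ _] /Krho xrho] _] [_ /= yrho'].
  by have := sup_dist_lip p x y; rewrite ler_norml => /andP[_]; move: rho'rho => ?; lra.
apply: le_trans (hausdorff1_separated _ sep) _; first by rewrite subr_gt0.
apply: hausdorff1_subset => x xW; split; last exact: WW.
by move: xW => [[[K /Hs[_ KG _ _ _] /KG]]|[]].
Qed.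

(** The competitor is the union of the pieces and of the boundary of the square, which every piece
    meets; the finite length of the pieces cancels. *)
Lemma ball_length_le_square : ball_length rho' <= 8 * rho.
Proof.
have [s Hs cov] := pieces.
have [Q [cQ Qrho HQ]] := sup_sphere_curve p rho0.
have cH : rectifiable_curve (family_union s `|` Q).
  apply: family_curveU => // K /Hs[cK _ _ [x Kx xrho] _]; split => //.
  by exists x; split => //; exact: Qrho.
have HG := minimal cH (fun x Gx => or_introl (cov x Gx)).
have sG : family_union s `<=` G by move=> x [K /Hs[_ KG _ _ _] /KG].
have := outer_inner_separated (W := setT) Hs (fun _ _ => I).
rewrite !setIT => Hsep.
have := le_trans Hsep (le_trans HG (le_trans (hausdorff1U _ _) (leeD2l _ HQ))).
by rewrite leeD2lE ?fin_subset.
Qed.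

Lemma ball_length_growth :
  9 / 8 * ball_length rho' + r <= ball_length (rho + r).
Proof.
have [s0 Hs0 cov0] := pieces.
(* Being an outer piece is stable under union of intersecting pieces, so the pieces can be made
   disjoint. *)
have [|s [Hs disj sE]] := disjoint_merge (P := outer_piece) _ Hs0.
  move=> A B [cA AG Arho [x Ax xrho] [y Ay yE]] [cB BG Brho _ _] AB; split.
  - exact: rectifiable_curveU.
  - by move=> z [/AG|/BG].
  - by move=> z [/Arho|/Brho].
  - by exists x => //; left.
  - by exists y => //; left.
have cov : G `&` near_E `<=` family_union s by rewrite sE.
have coverE z : E z -> exists2 x, family_union s x & edist x z < 3 * r.
  move=> Ez; have [x Gx xz] := G_near Ez; exists x => //.
  by apply: cov; split => //; exists z.
have sG : family_union s `<=` G by move=> x [K /Hs[_ KG _ _ _] /KG].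
pose W := [set x | sup_dist p x <= rho + r].
(* Along each piece [sup_dist p] takes all values from [rho] to [rho + r], which costs length [r]
   inside [W]. *)
have Hlow : (((size s)%:R * r)%:E <= hausdorff1 (family_union s `&` W))%E.
  apply: hausdorff1_disjoint_family disj _ => [K /Hs[]//|K /Hs].
  move=> [cK _ Krho [x Kx xrho] [y Ky yE]].
  have -> : r = rho + r - rho by ring.
  apply: (hausdorff1_ge_itv (sup_dist_lip p)) => v /andP[rv vr].
  have [|z Kz zv] := curve_ivt (v := v) cK (sup_dist_lip p) Kx Ky.
    by rewrite xrho rv (le_trans vr) // far.
  by exists z => //; split => //; rewrite /W /= zv.
have WW : family_union s `&` W `|` G `&` [set x | sup_dist p x <= rho'] `<=` W.
  by move=> x [[]//|[_]]; rewrite /W /= => H; move: r0 rho'rho => ? ?; lra.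
have := le_trans (leeD2r _ Hlow) (outer_inner_separated Hs WW).
rewrite ball_lengthE -EFinD lee_fin => Hgrow.
have := outer_inner_separated (W := setT) Hs (fun _ _ => I).
rewrite !setIT => Hsep.
(* There is at least one piece because [E] is nonempty; from here on the number of pieces is
   [(size s).+1]. *)
case: s => [|K s] in Hs disj sE cov coverE sG Hlow WW Hgrow Hsep *.
  by have [z /coverE[x [K []]]] := E0.
have r30 : 0 <= 3 * r by rewrite mulr_ge0 // ltW.
(* With [d = 3 * r] and [e = r], each joining segment costs at most 8 r. *)
have [|||H [cH sH HH]] := family_connect Econn r0 r30 (K := K) (s := s).
- by move=> A /Hs[].
- move=> A /Hs[_ _ _ _ [x Ax [z Ez xz]]].
  by exists z => //; exists x.
- exact: coverE.
have := le_trans Hsep (le_trans (minimal cH (subset_trans cov sH)) HH).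
rewrite leeD2lE ?fin_subset // lee_fin => Hle.
move: Hgrow; rewrite /= -natr1; move: Hle; rewrite !mulr2n.
by move: r0 => ?; nra.
Qed.

End Level.

Lemma minimizer_near : exists2 z, E z & edist p z <= 198 * r.
Proof.
apply: contrapT => noz.
(* The levels reach at most 86 r, whereas [x] is more than 195 r away from [p] and its sup distance
   to [p] is at least half of that. *)
have far k : (k <= 42)%N -> forall x, near_E x ->
    (k.*2.+1%:R * r) + r <= sup_dist p x.
  move=> k42 x [z Ez xz].
  have pz : 198 * r < edist p z.
    by rewrite ltNge; apply/negP => pz; apply: noz; exists z.
  have := edist_triangle x p z; have := edist_le_sup_dist p x; rewrite (edistC x p).
  have : k.*2.+1%:R * r <= 85 * r by rewrite ler_pM2r // ler_nat; lia.
  by move: r0 => ?; lra.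
have levels k : 0 <= k.*2%:R * r /\ k.*2%:R * r < k.*2.+1%:R * r.
  by split; [rewrite mulr_ge0 // ltW|rewrite ltr_pM2r // ltr_nat].
have upper k : (k <= 42)%N -> ball_length (k.*2%:R * r) <= 8 * (k.*2.+1%:R * r).
  move=> k42; have [? ?] := levels k.
  exact: ball_length_le_square (far _ k42).
have grow k : (k <= 42)%N ->
    9 / 8 * ball_length (k.*2%:R * r) + r <= ball_length (k.+1.*2%:R * r).
  move=> k42; have [? ?] := levels k.
  have -> : k.+1.*2%:R * r = k.*2.+1%:R * r + r.
    by rewrite doubleS -[k.*2.+2%:R]natr1 mulrDl mul1r.
  exact: ball_length_growth (far _ k42).
(* Adding 8 r absorbs the constant term: the recursion becomes multiplication by 9/8. *)
have lower k : (k <= 42)%N -> 8 * r * (9 / 8) ^+ k <= ball_length (k.*2%:R * r) + 8 * r.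
  elim: k => [|k IH] k42.
    by rewrite expr0 mulr1 lerDr fine_ge0 // hausdorff1_ge0.
  have := grow k (ltnW k42); have := IH (ltnW k42); rewrite exprS.
  by set q := _ ^+ k; lra.
have pow : 128 <= (9 / 8) ^+ 42 :> R.
  (* The sixth power of 9/8 already exceeds 2. Then 8 r * 128 = 1024 r, beyond the upper bound 8 *
     85 r + 8 r = 688 r. *)
  rewrite (exprM _ 6 7).
  have -> : 128 = 2 ^+ 7 :> R by ring.
  by rewrite lerXn2r ?nnegrE //; lra.
have := lower 42%N (leqnn _); have := upper 42%N (leqnn _).
have : 8 * r * 128 <= 8 * r * (9 / 8) ^+ 42 by rewrite ler_wpM2l // mulr_ge0 // ltW.
have -> : 42.*2.+1%:R = 85 :> R by [].
by set q := _ ^+ 42; move: r0 => ?; lra.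
Qed.

End Minimizer.

Theorem theorem4p1 (R : realType) :
  exists C : R, 1 < C /\
  forall (E : set (R * R)) (r : R) (G : set (R * R)),
    compact E -> E !=set0 -> path_connected E -> 0 < r ->
    max_dist_minimizer (nbhd_closed E r) r G ->
    nbhd_closed G r `<=` nbhd_closed E (C * r).
Proof.
(* 198 r from [E] to a point [p] of the curve, plus 2 r from [p] to [x], the second r being slack
   for the infimum. *)
exists 200; split; first by lra.
move=> E r G _ E0 Econn r0 Gmin x Gx.
have [p Gp xp] := nbhd_closed_lt Gx r0.
have [z Ez pz] := minimizer_near E0 Econn r0 Gmin Gp.
apply: nbhd_closed_near Ez _.
by have := edist_triangle p x z; lra.
Qed.
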